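(* Let $\mathcal{B}$ be a set and let $H,H'\subseteq 2^{\mathcal{B}}$ be downward-closed compsets. Then the quotient $H_q=H/H'$, i.e. the largest downward-closed compset $H_q$ with $H'\times H_q\subseteq H$, is $$H_q=\left\langle \bigcap_{M'\in\overline{H'}}\frac{\phi(M')}{M'}\right\rangle_{\phi:\overline{H'}\to\overline{H}},$$ where $\phi$ ranges over all functions from $\overline{H'}$ to $\overline{H}$, i.e. over all choices of a maximal component $\phi(M')\in\overline{H}$ for each $M'\in\overline{H'}$. Thus, if $H$ is $k$-conic and $H'$ is $k'$-conic, then the number of maximal components of $H/H'$ is bounded from above by $k^{k'}$.
   Context: Components are subsets of a fixed set $\mathcal{B}$ of behaviors, ordered by inclusion, with composition given by intersection; the quotient of components is the implication $\frac{M}{M'}=M\cup(\mathcal{B}\setminus M')$, the largest component whose intersection with $M'$ is contained in $M$. A compset is a set of components $H\subseteq 2^{\mathcal{B}}$; it is downward-closed if $M'\subseteq M\in H$ implies $M'\in H$. $\overline{H}=\{M\in H : \forall M'\in H,\ M\subseteq M'\Rightarrow M'=M\}$ is the set of maximal components of $H$. A downward-closed compset $H$ is called $k$-conic if $\overline{H}$ is finite of cardinality $k$. Here $2^M$ is the set of all subsets of $M$, and $\langle M_i\rangle_{i}$ denotes the downward-closed compset $\bigcup_i 2^{M_i}$. Composition of compsets is $H\times H'=\{M\cap M' : M\in H,\ M'\in H'\}$.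
   Formalization: It is additionally assumed that every component of H, and of H', lies below a maximal one; otherwise the claim is false, e.g. for H' the finite subsets of ℕ and H={∅}, where the formula gives all of 2^ℕ. *)

(* Defs.v *)
From mathcomp Require Import all_boot.
From mathcomp Require Import boolp classical_sets functions cardinality.

Set Implicit Arguments.
Unset Strict Implicit.
Unset Printing Implicit Defensive.

Local Open Scope classical_set_scope.
Local Open Scope card_scope.

(* A component over the behaviors [B] is a term of type [set B], a compset is a
   term of type [set (set B)].  [B] may be empty, and so may compsets. *)

Definition component_quotient (B : Type) (M M' : set B) : set B := M `|` ~` M'.

Definition downward_closed (B : Type) (H : set (set B)) : Prop :=
  forall M M' : set B, M' `<=` M -> H M -> H M'.

Definition maximal_components (B : Type) (H : set (set B)) : set (set B) :=
  [set M | H M /\ forall M' : set B, H M' -> M `<=` M' -> M' = M].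

(* <M_i>_{i : I}, that is, the union of the powersets of the [M i]. *)
Definition generated (B I : Type) (M : I -> set B) : set (set B) :=
  \bigcup_(i in [set: I]) [set N : set B | N `<=` M i].

(* This does not follow from [downward_closed]: the finite subsets of an
   infinite [B] form a downward-closed compset without maximal components. *)
Definition generated_by_maximal (B : Type) (H : set (set B)) : Prop :=
  H = generated (fun M : maximal_components H => set_val M).

Definition conic (B : Type) (k : nat) (H : set (set B)) : Prop :=
  downward_closed H /\ maximal_components H #= `I_k.

Definition compset_product (B : Type) (H H' : set (set B)) : set (set B) :=
  [set M `&` M' | M in H & M' in H'].

(* [Hq] is H / H'. *)
Definition is_compset_quotient (B : Type) (H H' Hq : set (set B)) : Prop :=
  [/\ downward_closed Hq,
      compset_product H' Hq `<=` H &
      forall K : set (set B),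
        downward_closed K -> compset_product H' K `<=` H -> K `<=` Hq].

(* Main.v *)
Require Import Defs.
From mathcomp Require Import all_boot.
From mathcomp Require Import boolp classical_sets functions cardinality.

Local Open Scope classical_set_scope.
Local Open Scope card_scope.

(** For [N] in the quotient, each maximal [M'] of [H'] satisfies
    [M' `&` N <= phi M'] for some maximal [phi M'] of [H], and by the adjunction
    between intersection and implication this means that [N] lies below
    [phi M' / M'].  Choosing [phi M'] for all [M'] at once gives the formula.
    A maximal component of a generated compset is one of its generators, hence
    the bound by the number of choice functions. *)

Lemma subset_component_quotient (B : Type) (M M' N : set B) :
  N `<=` component_quotient M M' <-> M' `&` N `<=` M.
Proof.
split=> [sN b [M'b /sN[//|/(_ M'b)//]]|sM b Nb].
by have [M'b|nM'b] := pselect (M' b); [left; apply: sM|right].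
Qed.

Lemma generated_by_maximalP (B : Type) (H : set (set B)) (N : set B) :
  generated_by_maximal H ->
  H N <-> exists M : maximal_components H, N `<=` set_val M.
Proof.
move=> genH; rewrite {1}genH.
by split=> [[M _ NM]|[M NM]]; exists M.
Qed.

(** A maximal [N] lies below some generator [M i], which itself belongs to the compset, so
    maximality forces [M i = N]. *)
Lemma maximal_components_generated (B I : Type) (M : I -> set B) :
  maximal_components (generated M) `<=` range M.
Proof.
by move=> N [[i _ NM] maxN]; exists i => //; apply: maxN => //; exists i.
Qed.

Lemma is_compset_quotient_unique (B : Type) (H H' K L : set (set B)) :
  is_compset_quotient H H' K -> is_compset_quotient H H' L -> K = L.
Proof.
move=> [dK pK maxK] [dL pL maxL].
by apply/seteqP; split; [apply: maxL|apply: maxK].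
Qed.

Lemma is_compset_quotient_generated (B : Type) (H H' : set (set B)) :
  generated_by_maximal H -> generated_by_maximal H' ->
  is_compset_quotient H H' (generated
    (fun phi : maximal_components H' -> maximal_components H =>
       \bigcap_(M' in [set: maximal_components H'])
          component_quotient (set_val (phi M')) (set_val M'))).
Proof.
move=> genH genH'; split.
- by move=> N N' N'N [phi _ sN]; exists phi => //; apply: subset_trans sN.
- move=> _ [N' H'N'] [N [phi _ sN] <-].
  (* Enlarging [N'] to a maximal [M'] makes the factor of the intersection indexed by [M']
     available, and [phi M'] is then the component of [H] above the product. *)
  have [M' N'M'] := (generated_by_maximalP _ _ _ genH').1 H'N'.
  apply/(generated_by_maximalP _ _ _ genH); exists (phi M').
  have /subset_component_quotient M'N : N `<=` _ := fun b Nb => sN b Nb M' I.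
  by move=> b [/N'M' M'b Nb]; apply: M'N.
- move=> K dK pK N KN.
  (* Each [M'] lies in [H'], so its intersection with [N] lies in [H], hence below a maximal
     component; the axiom of choice collects these components into [phi]. *)
  have /choice[phi phiP] : forall M' : maximal_components H',
      exists M : maximal_components H, set_val M' `&` N `<=` set_val M.
    move=> M'; apply/(generated_by_maximalP _ _ _ genH)/pK.
    exists (set_val M'); last by exists N.
    by apply/(generated_by_maximalP _ _ _ genH'); exists M'.
  exists phi => // b Nb M' _.
  by move: b Nb; apply/subset_component_quotient/phiP.
Qed.

Lemma card_setT_finType (T : finType) : [set: T] #= `I_#|T|.
Proof.
apply/card_set_bijP; exists (fun x : T => nat_of_ord (enum_rank x)); split.
- by move=> x _ /=.
- by move=> x y _ _ /val_inj/enum_rank_inj.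
- by move=> i /= ltiT; exists (enum_val (Ordinal ltiT)); rewrite ?enum_valK.
Qed.

(** Gives explicit enumerations of finite sets, along which functions between them can be
    transported to functions between ordinals. *)
Lemma card_ord_bijective {T : Type} {A : set T} {n : nat} :
  A #= `I_n -> exists f : A -> 'I_n, bijective f.
Proof.
move=> An; have /card_bijP[f bijf] : A #= [set: 'I_n].
  by have := card_setT_finType 'I_n; rewrite card_ord (card_eql An) card_eq_sym.
exists (fun x => set_val (f x)); apply: (bij_comp _ bijf).
by exists to_setT => // x; apply: val_inj.
Qed.

Lemma card_le_functions {T U : Type} {A : set T} {D : set U} {m n : nat} :
  A #= `I_m -> D #= `I_n -> [set: A -> D] #<= `I_(n ^ m).
Proof.
move=> /card_ord_bijective[f [f' fK f'K]] /card_ord_bijective[g [g' gK g'K]].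
have /card_eqPle[cardF _] := card_setT_finType {ffun 'I_m -> 'I_n}.
rewrite card_ffun !card_ord in cardF.
apply: card_le_trans cardF.
(* For an upper bound it is enough that transport from the [n ^ m] finite functions is
   surjective. *)
apply: card_le_trans (card_image_le
  (fun psi : {ffun 'I_m -> 'I_n} => fun x : A => g' (psi (f x))) _).
(* The preimage of [phi] is its conjugate by the two enumerations. *)
apply: subset_card_le => phi _; exists [ffun i => g (phi (f' i))] => //.
by apply/funext => x; rewrite ffunE fK gK.
Qed.

Theorem mainTheorem11 (B : Type) (H H' : set (set B))
    (dcH : downward_closed H) (dcH' : downward_closed H')
    (genH : generated_by_maximal H) (genH' : generated_by_maximal H') :
  (forall Hq : set (set B),
     is_compset_quotient H H' Hq <->
     Hq = generated
       (fun phi : maximal_components H' -> maximal_components H =>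
          \bigcap_(M' in [set: maximal_components H'])
             component_quotient (set_val (phi M')) (set_val M'))) /\
  (forall (k k' : nat) (Hq : set (set B)),
     conic k H -> conic k' H' -> is_compset_quotient H H' Hq ->
     maximal_components Hq #<= `I_(k ^ k')).
Proof.
have quot := is_compset_quotient_generated B H H' genH genH'.
split=> [Hq|k k' Hq [_ cardH] [_ cardH'] quotHq].
  by split=> [/is_compset_quotient_unique|->]; [apply|].
rewrite (is_compset_quotient_unique _ _ _ _ _ quotHq quot).
(* The generators are indexed by the functions from the [k'] maximal components of [H'] to the [k]
   of [H]. *)
apply: card_le_trans (subset_card_le (maximal_components_generated _ _ _)) _.
exact: card_le_trans (card_image_le _ _) (card_le_functions cardH' cardH).
Qed.
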